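(* Let $X$, $Y$ be two Banach spaces. Denote by $B$ the open ball of radius $R>0$ around the origin in $X$. Consider a map $f:B\rightarrow Y$ with $f(0)=0$. Assume the following. (i) $f$ is Lipschitz continuous and Gâteaux-differentiable on $B$. (ii) There are a function $L: B\to\mathcal{L}(Y,X)$, a constant $a<1$ and, for any $(x,w)\in B\times Y$, a positive radius $\alpha(x,w)$ such that, for every $x'\in X$, if $\Vert x'-x\Vert_X<\alpha(x,w)$ then $x'\in B$ and $$\left\Vert \left(Df(x')\circ L(x)-I_Y\right)w\right\Vert_Y\leq a\Vert w\Vert_Y .$$ (iii) There is some $m<\infty$ such that $$\sup\left\{\Vert L(x)\Vert_{Y,X}\ :\ x\in B\right\}<m .$$ Denote by $B'\subset Y$ the open ball of radius $R':=(1-a)Rm^{-1}$ and center $0$. Then there is a continuous map $g:B'\rightarrow B$ such that $$\forall y\in B',\qquad \Vert g(y)\Vert_X\leq\frac{m}{1-a}\Vert y\Vert_Y\quad\text{and}\quad f\circ g(y)=y .$$ If, in addition, the following holds: (iv) $f$ is Fréchet differentiable on $B$, $Df(x)$ has a left-inverse for all $x\in B$, and there is a non-decreasing function $\varepsilon:(0,\infty)\to(0,\infty)$ with $\lim_{t\to 0}\varepsilon(t)=0$ such that for all $x_1,x_2$ in $B$, $$\Vert f(x_2)-f(x_1)-Df(x_1)(x_2-x_1)\Vert_Y\leq\varepsilon(\Vert x_2-x_1\Vert_X)\,\Vert x_2-x_1\Vert_X ;$$ then $g$ is the unique continuous right-inverse of $f$ defined on $B'$ and mapping $0_Y$ to $0_X$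 (that is, the unique continuous map $g:B'\to B$ with $f\circ g=I_{B'}$ and $g(0_Y)=0_X$).
   Context: $\mathcal{L}(X,Y)$ denotes the space of bounded linear operators between Banach spaces $X$ and $Y$, with operator norm $\Vert\cdot\Vert_{X,Y}$; $I_Y$ is the identity of $Y$. The map $f:B\to Y$ is Gâteaux-differentiable on $B$ if for every $x\in B$ there is $Df(x)\in\mathcal{L}(X,Y)$ such that for every $h\in X$, $\lim_{t\to0}\frac1t\left(f(x+th)-f(x)\right)=Df(x)h$ in $Y$. No continuity of $L$ is assumed. A left-inverse of $Df(x)$ is an operator $M\in\mathcal{L}(Y,X)$ with $M\circ Df(x)=I_X$. In (iv), the right-hand side of the inequality is read as $0$ when $x_1=x_2$. *)

(* Defs.v *)
From HB Require Import structures.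
From mathcomp Require Export all_boot all_order all_algebra.
From mathcomp Require Export all_classical all_reals all_analysis.

Set Implicit Arguments.
Unset Strict Implicit.
Unset Printing Implicit Defensive.

Import Order.TTheory GRing.Theory Num.Theory.
Import numFieldNormedType.Exports.

Local Open Scope classical_set_scope.
Local Open Scope ring_scope.

Record bounded_operator (R : realType) (V W : normedModType R) :=
  BoundedOperator {
    bop_linear :> {linear V -> W};
    bop_bounded : bounded_fun_norm bop_linear
  }.

(* The set is nonempty (v = 0) and bounded (bop_bounded), so this real-valued
   sup is the genuine supremum. *)
Definition opnorm (R : realType) (V W : normedModType R)
    (A : bounded_operator V W) : R :=
  sup [set `|A v| | v in [set v : V | `|v| <= 1]].

(* When x is interior to the domain of interest, the values of f outside that
   domain are irrelevant, as is_derive is a limit at t -> 0, t != 0. *)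
Definition is_gateaux_diff (R : realType) (V W : normedModType R)
    (f : V -> W) (x : V) (A : bounded_operator V W) : Prop :=
  forall h : V, is_derive x h f (A h).

Definition has_left_inverse (R : realType) (V W : normedModType R)
    (A : bounded_operator V W) : Prop :=
  exists M : bounded_operator W V, forall h : V, M (A h) = h.

Definition continuous_right_inverse (R : realType) (V W : normedModType R)
    (f : V -> W) (B : set V) (B' : set W) (g : W -> V) : Prop :=
  [/\ {within B', continuous g},
      (forall y, B' y -> B (g y)) &
      (forall y, B' y -> f (g y) = y)].

(* Main.v *)
Require Import Defs.
From mathcomp Require Import wochoice lra ring.
Import Order.TTheory GRing.Theory Num.Theory.
Import numFieldNormedType.Exports.
Local Open Scope classical_set_scope.
Local Open Scope ring_scope.

(** Write [c = m / (1 - a)] and, for a target [y], call [|y - f x|] the residual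
    at [x].  The solution is reached by iterating one continuous step
    [x |-> S (y, x)] from [x = 0].  The step moves [x] by at most [c] times the
    decrease of the residual, and fixes [x] only if [f x = y].

    Given such an [S] ([descent_step]), the conclusion is soft
    ([continuous_descent]).  The iterates [x_n y] are continuous in [y], have
    total length at most [c |y| < r] and converge; the limit is a fixed point of
    [S (y, _)] by continuity of [S], hence a solution.  As
    [|g y - x_n y| <= c |y - f (x_n y)|], where the right-hand side is continuous
    in [y] and decreases to zero with [n], the convergence is locally uniform (as
    in Dini's theorem) and [g] is continuous.

    To construct [S], note that at [t = (y, x)] with residual vector
    [w t = y - f x] the direction [L x (w t)] is a descent direction, but it is
    not continuous in [t].  The hypothesis on [alpha] says however that the
    direction [L x_i (w t_i)] computed at [t_i = (y_i, x_i)] is still good at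
    every [t] near [t_i], and being a good direction is a convex condition.  A
    locally finite family of weights ([locally_finite_weights]) glues these
    directions continuously ([continuous_convex_selection]); it also produces a
    continuous step length so small that the whole segment travelled stays where
    each direction used is good.  The mean value inequality along that segment
    ([norm_mean_value]) then bounds the residual.  Only directional derivatives
    enter, which is why Gateaux differentiability suffices.

    For uniqueness, a left inverse of [Df x] is forced to satisfy a uniform bound
    ([left_inverse_lower_bound]), so [Df x] is uniformly bounded below.  With the
    modulus [eps] this makes distinct solutions of [f x = y] uniformly separated,
    and two continuous right inverses that agree at [0] cannot separate along the
    segment from [0] to [y] ([right_inverse_unique]). *)

(** * Locally finite weights on a normed space *)

(** A strict form of the well-ordering theorem, keeping only comparability of
    distinct elements and existence of first elements. *)
Lemma exists_strict_well_order (I : eqType) :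
  exists lt : I -> I -> Prop,
    (forall i j, i <> j -> lt i j \/ lt j i) /\
    (forall A : set I, A !=set0 -> exists2 z, A z & forall j, lt j z -> ~ A j).
Proof.
have [le woI] := well_ordering_principle I.
have woC : wo_chain le predT by move=> A _; exact: woI.
have asym := wo_chain_antisymmetric woC.
exists (fun i j => le i j /\ i <> j); split.
  move=> i j ij.
  have [|z [[zij lez] _]] := woI (pred2 i j); first by exists i; rewrite !inE eqxx.
  move: zij; rewrite !inE => /orP[] /eqP ez; subst z.
    by left; split=> //; apply: lez; rewrite !inE eqxx orbT.
  by right; split; [apply: lez; rewrite !inE eqxx|exact: nesym].
move=> A [x Ax].
have [|z [[zA lez] _]] := woI (fun i => `[< A i >]).
  by exists x; apply/asboolP.
exists z; first exact/asboolP.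
move=> j [lejz jz] Aj; apply: jz; apply: asym => //.
by rewrite lejz lez //; apply/asboolP.
Qed.

Section BoundedSup.
Context {R : realType} {I : Type}.
Implicit Types (A : set I) (e : I -> R).

Let has_ubound_image A e : (forall i, e i <= 1) -> has_ubound (e @` A).
Proof. by move=> e1; exists 1 => _ [i _ <-]. Qed.

Lemma le_sup_image A e i : (forall i, e i <= 1) -> A i -> e i <= sup (e @` A).
Proof. by move=> e1 Ai; apply: ub_le_sup; [exact: has_ubound_image|exists i]. Qed.

Lemma sup_image_le A e u :
  0 <= u -> (forall i, A i -> e i <= u) -> sup (e @` A) <= u.
Proof.
move=> u0 eu; have [->|A0] := eqVneq A set0; first by rewrite image_set0 sup0.
apply: ge_sup => [|_ [i Ai <-]]; last exact: eu.
by move/set0P: A0 => [i Ai]; exists (e i); exists i.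
Qed.

Lemma sup_image_ge0 A e : (forall i, 0 <= e i <= 1) -> 0 <= sup (e @` A).
Proof.
move=> e01; have [->|] := eqVneq A set0; first by rewrite image_set0 sup0.
move=> /set0P[i Ai]; have /andP[ei0 _] := e01 i.
by apply: le_trans ei0 _; apply: le_sup_image => // j; case/andP: (e01 j).
Qed.

End BoundedSup.

(** Lipschitz estimates are kept one-sided because this form passes directly to
    suprema and positive parts; exchanging [s] and [t] recovers the usual one. *)
Lemma sup_image_lip {R : realType} {V : normedModType R} {I : Type}
    (A : set I) (e : I -> V -> R) (k : R) (s t : V) :
  0 <= k -> (forall i v, 0 <= e i v <= 1) ->
  (forall i, e i s <= e i t + k * `|s - t|) ->
  sup (e^~ s @` A) <= sup (e^~ t @` A) + k * `|s - t|.
Proof.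
move=> k0 e01 elip; apply: sup_image_le.
  by rewrite addr_ge0 ?mulr_ge0// sup_image_ge0.
move=> i Ai; apply: le_trans (elip i) _; rewrite lerD2r.
by apply: (@le_sup_image _ _ _ (e^~ t)) => // j; case/andP: (e01 j t).
Qed.

Lemma one_sided_lip_continuous {R : realType} {V : normedModType R}
    (u : V -> R) (k : R) :
  (forall s t, u s <= u t + k * `|s - t|) -> continuous u.
Proof.
move=> ulip t; apply/cvgrPdist_le => e e0.
have k1 : 0 < `|k| + 1 by rewrite ltr_pwDr.
near=> s.
have st : `|s - t| <= e / (`|k| + 1).
  by rewrite distrC; near: s; apply: cvgr_dist_le => //; rewrite divr_gt0.
have key : k * `|s - t| <= e.
  apply: (@le_trans _ _ ((`|k| + 1) * `|s - t|)).
    by rewrite ler_wpM2r// (le_trans (ler_norm k))// lerDl.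
  by rewrite mulrC -ler_pdivlMr.
have h1 := ulip s t; have h2 := ulip t s; rewrite (distrC t s) in h2.
by rewrite ler_norml; apply/andP; split; lra.
Unshelve. all: by end_near. Qed.

(** Pigeonhole on the integer parts of [u i / e]. *)
Lemma separated_finite_set {R : realType} {I : Type} (A : set I) (u : I -> R)
    (e : R) :
  0 < e -> (forall i, 0 <= u i <= 1) ->
  (forall i j, A i -> A j -> i <> j -> e < `|u i - u j|) -> finite_set A.
Proof.
move=> e0 u01 sep.
pose n i := Num.truncn (u i / e).
have nP i : (n i)%:R * e <= u i < (n i).+1%:R * e.
  by rewrite -ler_pdivlMr// -ltr_pdivrMr// truncn_itv// divr_ge0 ?(ltW e0)//; case/andP: (u01 i).
have ninj : set_inj A n.
  move=> i j; rewrite !inE => Ai Aj nij; apply: contrapT => ij.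
  have := sep _ _ Ai Aj ij; apply/negP; rewrite -leNgt.
  have := nP i; have := nP j; rewrite nij -natr1 mulrDl mul1r => /andP[a1 a2] /andP[b1 b2].
  by rewrite ler_norml; apply/andP; split; lra.
rewrite -(eq_finite_set (inj_card_eq ninj)).
apply: (@sub_finite_set _ _ `I_(Num.truncn e^-1).+1) => // _ [i Ai <-] /=.
rewrite ltnS; apply: le_truncn; rewrite ler_pdivrMr// mulVf ?gt_eqF//.
by case/andP: (u01 i).
Qed.

Lemma max0_le_add {R : realType} (x y k : R) :
  0 <= k -> x <= y + k -> Num.max 0 x <= Num.max 0 y + k.
Proof.
have y1 : y <= Num.max 0 y by rewrite le_max lexx orbT.
have y0 : 0 <= Num.max 0 y by rewrite le_max lexx.
by move=> k0 xy; rewrite ge_max; apply/andP; split; lra.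
Qed.

(** Paracompactness in a quantitative form, for the sets where [d i > 0].  Well-order
    [I] and let [p j] be the positive part of [d j - sup_(i < j) d i].  If [j]
    and [k] both satisfy [p _ t > e], then [d j t] and [d k t] differ by more
    than [e]; as these numbers lie in the unit interval, only finitely many [j]
    satisfy [p j t > e].  All [p j] being 2-Lipschitz, the weights
    [q j = max 0 (p j - s / 2)], with [s = sup_j p j], are locally finite where
    [s > 0], and [s t > 0] at every [t] where some [d i t] is positive, since [p]
    agrees with [d] at the first such index.  The function [h = s / 2] bounds
    [d j] from below on the support of [q j]: this control of all the active
    [d j] by one continuous function is what later gives the step length. *)
Lemma locally_finite_weights {R : realType} {V : normedModType R} {I : eqType}
    (d : I -> V -> R) :
  (forall i t, 0 <= d i t <= 1) ->
  (forall i s t, d i s <= d i t + `|s - t|) ->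
  exists (q : I -> V -> R) (h : V -> R),
    [/\ continuous h, (forall i, continuous (q i)), (forall i t, 0 <= q i t),
        (forall i t, 0 < q i t -> 0 < h t <= d i t) &
        (forall i t, 0 < d i t -> (exists j, 0 < q j t) /\
          exists2 F : set I, finite_set F &
            \forall s \near t, forall j, ~ F j -> q j s = 0)].
Proof.
move=> d01 dlip.
have [lt [lt_total lt_min]] := exists_strict_well_order I.
pose before j := [set i | lt i j].
pose p j t := Num.max 0 (d j t - sup (d^~ t @` before j)).
pose sg t := sup (p^~ t @` setT).
pose q j t := Num.max 0 (p j t - sg t / 2).
have d1 t i : d i t <= 1 by case/andP: (d01 i t).
have p01 j t : 0 <= p j t <= 1.
  rewrite /p le_max lexx/= ge_max ler01/=.
  have := d1 t j; have : 0 <= sup (d^~ t @` before j) by exact: sup_image_ge0.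
  lra.
have p_le j t : p j t <= d j t.
  rewrite /p ge_max; have /andP[-> _] := d01 j t; rewrite lerBlDr lerDl.
  exact: sup_image_ge0.
have p_lip j s t : p j s <= p j t + 2 * `|s - t|.
  have h1 := dlip j s t.
  have : sup (d^~ t @` before j) <= sup (d^~ s @` before j) + 1 * `|t - s|.
    by apply: sup_image_lip => // i; rewrite mul1r.
  rewrite mul1r distrC => h2.
  rewrite /p; set A := sup _ in h2 *; set B := sup _ in h2 *.
  have := normr_ge0 (s - t) => h3.
  by apply: max0_le_add; lra.
have p_sg j t : p j t <= sg t.
  by apply: (@le_sup_image _ _ _ (p^~ t)) => // i; case/andP: (p01 i t).
have sg0 t : 0 <= sg t by apply: sup_image_ge0.
have sg_lip s t : sg s <= sg t + 2 * `|s - t| by exact: sup_image_lip.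
have sg_cont : continuous sg by exact: one_sided_lip_continuous sg_lip.
exists q, (fun t => sg t / 2); split.
- by move=> t; apply: cvgMl; exact: sg_cont.
- move=> j; apply: (@one_sided_lip_continuous _ _ _ 3) => s t.
  have h1 := p_lip j s t; have h2 := sg_lip t s; rewrite distrC in h2.
  have := normr_ge0 (s - t) => h3.
  by apply: max0_le_add; lra.
- by move=> j t; rewrite /q le_max lexx.
- move=> j t; rewrite /q lt_max ltxx/= => qj.
  by have := p_sg j t; have := p_le j t => h1 h2; apply/andP; split; lra.
move=> i t dit.
have sgt : 0 < sg t.
  (* at the first index z with d z t > 0 nothing is subtracted from d z t *)
  have [z dz zmin] := lt_min [set j | 0 < d j t] (ex_intro _ i dit).
  apply: lt_le_trans (p_sg z t); rewrite /p lt_max ltxx/=.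
  suff : sup (d^~ t @` before z) <= 0 by move: dz => /=; lra.
  by apply: sup_image_le => // j /zmin/negP; rewrite -leNgt.
split.
  have [_ [j _ <-] pj] : exists2 x, (p^~ t @` setT) x & sg t / 2 < x.
    apply: sup_gt; first by exists (p i t); exists i.
    by rewrite -/(sg t); lra.
  by exists j; rewrite /q lt_max ltxx/= subr_gt0.
exists [set j | sg t / 4 < p j t].
  apply: (@separated_finite_set _ _ _ (d^~ t) (sg t / 4)) => //.
    by rewrite divr_gt0.
  (* p k t > e means that d k t exceeds every earlier d j t by more than e *)
  have wlog_sep j k : lt j k -> sg t / 4 < p k t -> sg t / 4 < d k t - d j t.
    move=> jk; rewrite /p lt_max => /orP[|]; first by lra.
    suff : d j t <= sup (d^~ t @` before k) by lra.
    exact: (@le_sup_image _ _ _ (d^~ t)).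
  move=> j k /= Fj Fk jk; have [jk'|jk'] := lt_total _ _ jk.
    by rewrite distrC; apply: lt_le_trans (ler_norm _); exact: wlog_sep.
  by apply: lt_le_trans (ler_norm _); exact: wlog_sep.
near=> s => j /= /negP; rewrite -leNgt => pj.
have st : `|t - s| < sg t / 12.
  by near: s; apply: cvgr_dist_lt => //; rewrite divr_gt0.
have h1 := p_lip j s t; have h2 := sg_lip t s; rewrite distrC in h1.
by rewrite /q; apply/max_idPl; lra.
Unshelve. all: by end_near. Qed.

(** The Browder-Michael selection principle for locally constant choices: [v i] is
    admissible where [d i > 0], and [phi t] is a convex combination of choices
    admissible at [t].  The choices used at [t] moreover satisfy [h t <= d i t],
    so each of them remains admissible on the whole open ball of radius [h t]
    around [t], the [d i] being 1-Lipschitz. *)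
Lemma continuous_convex_selection {R : realType} {V W : normedModType R}
    {I : choiceType} (d : I -> V -> R) (v : I -> W) :
  (forall i t, 0 <= d i t <= 1) ->
  (forall i s t, d i s <= d i t + `|s - t|) ->
  exists (h : V -> R) (phi : V -> W), continuous h /\
    forall i t, 0 < d i t ->
    [/\ {for t, continuous phi}, 0 < h t &
        exists (s : seq I) (c : I -> R),
         [/\ forall j, 0 <= c j, \sum_(j <- s) c j = 1,
             phi t = \sum_(j <- s) c j *: v j &
             forall j, j \in s -> h t <= d j t]].
Proof.
move=> d01 dlip.
have [q [h [hcont qcont q0 qact qfin]]] := locally_finite_weights _ d01 dlip.
pose Q t := \sum_(j \in [set: I]) q j t.
pose N t := \sum_(j \in [set: I]) q j t *: v j.
exists h, (fun t => (Q t)^-1 *: N t); split=> // i t dit.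
have [[k qk] [F Ffin qF]] := qfin _ _ dit.
pose sF : seq I := finmap.enum_fset (fset_set F).
have QE s : (forall j, ~ F j -> q j s = 0) -> Q s = \sum_(j <- sF) q j s.
  move=> qs; rewrite /Q -(fsbig_widen F) ?fsbig_finite// => j [_ Fj].
  exact: qs.
have NE s : (forall j, ~ F j -> q j s = 0) ->
    N s = \sum_(j <- sF) q j s *: v j.
  move=> qs; rewrite /N -(fsbig_widen F) ?fsbig_finite// => j [_ Fj] /=.
  by rewrite qs ?scale0r.
have qFt := nbhs_singleton qF.
have Qt : 0 < Q t.
  rewrite QE// (@lt_le_trans _ _ (q k t))//.
  have kF : k \in sF.
    rewrite in_fset_set// inE; apply: contrapT => /qFt qk0.
    by rewrite qk0 ltxx in qk.
  by rewrite (big_rem k)//= lerDl sumr_ge0.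
have Qcont : {for t, continuous Q}.
  apply: (@cvg_trans _ ((fun s => \sum_(j <- sF) q j s) @ t)).
    by apply: near_eq_cvg; near do [symmetry; apply: QE].
  rewrite QE//; apply: cvg_big => [|j _]; last exact: qcont.
  exact: add_continuous.
have Ncont : {for t, continuous N}.
  apply: (@cvg_trans _ ((fun s => \sum_(j <- sF) q j s *: v j) @ t)).
    by apply: near_eq_cvg; near do [symmetry; apply: NE].
  rewrite NE//; apply: cvg_big => [|j _]; first exact: add_continuous.
  by apply: cvgZl; exact: qcont.
split.
- by apply: cvgZ => //; apply: cvgV => //; rewrite gt_eqF.
- by case/andP: (qact _ _ qk).
exists [seq j <- sF | 0 < q j t], (fun j => (Q t)^-1 * q j t); split.
- by move=> j; rewrite mulr_ge0// invr_ge0 ltW.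
- rewrite -mulr_sumr big_filter big_mkcond/= -(@mulVf _ (Q t)) ?gt_eqF//.
  congr (_ * _); rewrite QE//; apply: eq_bigr => j _.
  by case: ltP => // qj0; apply/le_anti; rewrite q0 qj0.
- rewrite NE// scaler_sumr big_filter [in RHS]big_mkcond/=.
  apply: eq_bigr => j _; rewrite scalerA; case: ltP => // qj0.
  suff -> : q j t = 0 by rewrite mulr0 scale0r.
  by apply/le_anti; rewrite q0 qj0.
- by move=> j; rewrite mem_filter => /andP[/qact/andP[]].
Unshelve. all: by end_near. Qed.

(** * The mean value inequality for vector-valued curves *)

Lemma is_derive_along_line {R : realType} {V W : normedModType R}
    (f : V -> W) (x v : V) (s : R) (df : W) :
  is_derive (x + s *: v) v f df ->
  is_derive s (1 : R) (fun t => f (x + t *: v)) df.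
Proof.
have E : (fun h : R => h^-1 *: (f (x + (h *: (1 : R) + s) *: v) - f (x + s *: v)))
    = (fun h => h^-1 *: (f (h *: v + (x + s *: v)) - f (x + s *: v))).
  apply/funext => h; congr (_ *: (f _ - _)).
  by rewrite scalerDl addrCA /GRing.scale/= mulr1.
case=> fd fv; split.
  by rewrite /derivable /comp /shift/= E.
by rewrite -fv /derive /comp /shift/= E.
Qed.

(** The function [u s = |psi s - psi 0| - (k + e') s] strictly decreases
    immediately to the right of every point of [[0, h)], so its minimum over [[0, h]] can
    only be attained at [h]; hence [u h <= u 0 = 0]. *)
Lemma norm_mean_value {R : realType} {W : normedModType R} (psi dpsi : R -> W)
    (k h : R) : 0 <= h ->
  (forall s, 0 <= s <= h -> is_derive s (1 : R) psi (dpsi s)) ->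
  (forall s, 0 <= s <= h -> `|dpsi s| <= k) ->
  `|psi h - psi 0| <= k * h.
Proof.
move=> h0 psid dk; apply/ler_addgt0Pr => e e0.
have h1 : 0 < h + 1 by lra.
pose e' := e / (h + 1).
have e'0 : 0 < e' by rewrite divr_gt0.
pose u s := `|psi s - psi 0| - (k + e') * s.
have ucont : {within `[0, h], continuous u}.
  apply: continuous_in_subspaceT => s; rewrite inE/= in_itv/= => s0h.
  have [psis _] := psid s s0h.
  have psic : {for s, continuous psi}.
    by apply: differentiable_continuous; exact/derivable1_diffP.
  apply: cvgB; last by apply: cvgM; [exact: cvg_cst|exact: cvg_id].
  by apply: cvg_norm; apply: cvgB => //; exact: cvg_cst.
have [c c0h cmin] := EVT_min h0 ucont.
have [ch|] := eqVneq c h.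
  have := cmin 0; rewrite in_itv/= lexx h0 => /(_ isT).
  rewrite ch /u subrr normr0 mulr0 subr0 => uh.
  have : e' * h <= e.
    rewrite /e' mulrAC ler_pdivrMr// ler_pM2l//; lra.
  lra.
move=> ch; move: (c0h); rewrite in_itv/= => c0h'; have /andP[c0 ch'] := c0h'.
(* a minimum at c < h is contradicted by a small step to the right of c *)
have {}ch : c < h by rewrite lt_neqAle ch.
have [dc dcE] := psid c c0h'.
have /cvgrPdist_lt /(_ _ e'0) : h^-1 *: (psi (h + c) - psi c) @[h --> 0^'] --> dpsi c.
  have -> : (fun h : R => h^-1 *: (psi (h + c) - psi c)) =
      (fun h => h^-1 *: ((psi \o shift c) (h *: (1 : R)) - psi c)).
    by apply/funext => t; rewrite /GRing.scale/= mulr1.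
  by rewrite -dcE; exact: dc.
rewrite near_withinE => /nbhs_norm0P[/= eta eta0 etaP].
pose t := Num.min (eta / 2) (h - c).
have t0 : 0 < t by rewrite lt_min subr_gt0 ch divr_gt0.
have teta : t < eta.
  by rewrite gt_min; apply/orP; left; rewrite ltr_pdivrMr// ltr_pMr// ltr1n.
have tch : t <= h - c by rewrite ge_min lexx orbT.
have := etaP t; rewrite /= gtr0_norm// => /(_ teta (lt0r_neq0 t0)) Ht.
have psit : `|psi (t + c) - psi c| < (k + e') * t.
  have -> : psi (t + c) - psi c = t *: (t^-1 *: (psi (t + c) - psi c)).
    by rewrite scalerA mulfV ?scale1r// gt_eqF.
  rewrite normrZ gtr0_norm// mulrC ltr_pM2r//.
  rewrite -[X in `|X|](subrK (dpsi c)) (le_lt_trans (ler_normD _ _))//.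
  by rewrite distrC addrC ler_ltD// dk.
have : u c <= u (t + c).
  by apply: cmin; rewrite in_itv/=; apply/andP; split; lra.
rewrite /u leNgt => /negP; case.
have : `|psi (t + c) - psi 0| <= `|psi (t + c) - psi c| + `|psi c - psi 0|.
  exact: ler_distD.
by rewrite mulrDr; lra.
Qed.

(** * Iterating a continuous descent step *)

(** A parametrized Caristi fixed point theorem.  The potential [rho] pays for the
    displacement, so the iterates are Cauchy and stay in the ball of radius [r];
    continuity of the step makes the limit a fixed point, where [rho] vanishes.
    Continuity of the limit in the parameter comes from the a posteriori bound
    [|g y - x_k y| <= c rho (y, x_k y)]: for fixed [k] its right-hand side is
    continuous in [y], and it is small at a given [y] for [k] large. *)
Lemma continuous_descent {R : realType} {P : topologicalType}
    {X : completeNormedModType R} (Q : set P) (r c : R) (S : P * X -> X)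
    (rho : P * X -> R) :
  open Q -> 0 < c -> (forall z, 0 <= rho z) ->
  (forall y x, Q y -> `|x| < r ->
     {for (y, x), continuous S} /\ {for (y, x), continuous rho}) ->
  (forall y x, Q y -> `|x| < r ->
     `|S (y, x) - x| <= c * (rho (y, x) - rho (y, S (y, x)))) ->
  (forall y x, Q y -> `|x| < r -> S (y, x) = x -> rho (y, x) = 0) ->
  (forall y, Q y -> c * rho (y, 0) < r) ->
  exists g : P -> X, forall y, Q y ->
    [/\ {for y, continuous g}, `|g y| <= c * rho (y, 0) & rho (y, g y) = 0].
Proof.
move=> Qo c0 rho0 cont desc fixp start.
pose x n y := iter n (fun x => S (y, x)) 0.
have x_in y n : Q y -> `|x n y| <= c * (rho (y, 0) - rho (y, x n y)).
  move=> Qy; elim: n => [|n IH]; first by rewrite /= normr0 subrr mulr0.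
  have xr : `|x n y| < r.
    apply: le_lt_trans IH _; apply: le_lt_trans (start _ Qy).
    by rewrite ler_pM2l// gerBl.
  have := desc y _ Qy xr; rewrite -[S (y, x n y)]/(x n.+1 y) => d.
  have := ler_normD (x n.+1 y - x n y) (x n y); rewrite subrK.
  by move: d IH; rewrite !mulrBr; lra.
have x_r y n : Q y -> `|x n y| < r.
  move=> Qy; apply: le_lt_trans (x_in y n Qy) _.
  by apply: le_lt_trans (start _ Qy); rewrite ler_pM2l// gerBl.
have x_dist y k n : Q y ->
    `|x (k + n)%N y - x k y| <= c * (rho (y, x k y) - rho (y, x (k + n)%N y)).
  move=> Qy; elim: n => [|n IH]; first by rewrite addn0 !subrr normr0 mulr0.
  have := desc y _ Qy (x_r y (k + n)%N Qy).
  rewrite -[S (y, x (k + n)%N y)]/(x (k + n).+1 y) -addnS => d.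
  have := ler_normD (x (k + n.+1)%N y - x (k + n)%N y) (x (k + n)%N y - x k y).
  rewrite addrA subrK.
  by move: d IH; rewrite !mulrBr; lra.
have x_cont n y : Q y -> {for y, continuous (x n)}.
  move=> Qy; elim: n => [|n IH]; first exact: cvg_cst.
  have [Sc _] := cont y (x n y) Qy (x_r y n Qy).
  apply: (@cvg_comp _ _ _ (fun y => (y, x n y)) S _ (nbhs (y, x n y)) _ _ Sc).
  by apply: cvg_pair => //; exact: cvg_id.
have rho_cont n y : Q y -> rho (z, x n z) @[z --> y] --> rho (y, x n y).
  move=> Qy; have [_ rc] := cont y (x n y) Qy (x_r y n Qy).
  apply: (@cvg_comp _ _ _ (fun y => (y, x n y)) rho _ (nbhs (y, x n y)) _ _ rc).
  by apply: cvg_pair; [exact: cvg_id|exact: x_cont].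
have rho_anti y n k : Q y -> (n <= k)%N -> rho (y, x k y) <= rho (y, x n y).
  move=> Qy /subnKC <-; have := x_dist y n (k - n)%N Qy.
  by move=> /(le_trans (normr_ge0 _)); rewrite pmulr_rge0// subr_ge0.
have x_cvg y : Q y -> cvgn (x^~ y).
  move=> Qy; apply/cauchy_cvgP/cauchy_exP => e e0.
  pose u n := rho (y, x n y).
  have ucvg : cvgn u.
    apply: nonincreasing_is_cvgn => [n k nk|]; first exact: rho_anti.
    by exists 0 => _ [n _ <-]; exact: rho0.
  have e4 : 0 < e / (c * 4) by rewrite divr_gt0// mulr_gt0.
  have /cvgrPdist_lt/(_ _ e4)[N _ HN] := ucvg.
  have close n : (N <= n)%N -> `|x N y - x n y| < e / 2.
    move=> Nn; have := x_dist y N (n - N)%N Qy; rewrite subnKC// distrC.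
    move=> /le_lt_trans; apply.
    have := HN N (leqnn _); have := HN n Nn; rewrite /= -/(u N) -/(u n) => h1 h2.
    rewrite -ltr_pdivlMl//.
    have -> : c^-1 * (e / 2) = 2 * (e / (c * 4)).
      by field; rewrite gt_eqF.
    move: h1 h2; rewrite !ltr_norml => /andP[? ?] /andP[? ?]; lra.
  exists (x N y); exists N => // n /= /close h.
  by rewrite -ball_normE/=; lra.
pose g y := limn (x^~ y).
have g_lim y : Q y -> x n y @[n --> \oo] --> g y by exact: x_cvg.
have g_dist y k : Q y -> `|g y - x k y| <= c * rho (y, x k y).
  move=> Qy; have /cvg_norm gk : (x n y - x k y) @[n --> \oo] --> g y - x k y.
    by apply: cvgB; [exact: g_lim|exact: cvg_cst].
  rewrite -(cvg_lim _ gk)//; apply: limr_le; first by apply/cvg_ex; exists `|g y - x k y|.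
  near=> n; have kn : (k <= n)%N by near: n; exists k.
  have := x_dist y k (n - k)%N Qy; rewrite subnKC// => /le_trans; apply.
  by rewrite ler_pM2l// gerBl.
have g_le y : Q y -> `|g y| <= c * rho (y, 0).
  by move=> Qy; have := g_dist y 0%N Qy; rewrite subr0.
have g_r y : Q y -> `|g y| < r.
  by move=> Qy; apply: le_lt_trans (start _ Qy); exact: g_le.
have g_rho y : Q y -> rho (y, g y) = 0.
  move=> Qy; apply: fixp => //; first exact: g_r.
  have [Sc _] := cont y (g y) Qy (g_r y Qy).
  have gS : x n.+1 y @[n --> \oo] --> S (y, g y).
    apply: (@cvg_comp _ _ _ (fun n => (y, x n y)) S _ (nbhs (y, g y)) _ _ Sc).
    by apply: cvg_pair; [exact: cvg_cst|exact: g_lim].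
  have gS' : x n.+1 y @[n --> \oo] --> g y.
    by have := g_lim y Qy; rewrite -(cvg_shiftS (x^~ y)).
  exact: (cvg_unique _ gS gS').
exists g => y Qy; split=> //; [|exact: g_le|exact: g_rho].
apply/cvgrPdist_lt => e e0.
have e3 : 0 < e / (c * 3) by rewrite divr_gt0// mulr_gt0.
have [k rk] : exists k, rho (y, x k y) < e / (c * 3).
  have [_ rc] := cont y (g y) Qy (g_r y Qy).
  have : rho (y, x n y) @[n --> \oo] --> rho (y, g y).
    apply: (@cvg_comp _ _ _ (fun n => (y, x n y)) rho _ (nbhs (y, g y)) _ _ rc).
    by apply: cvg_pair; [exact: cvg_cst|exact: g_lim].
  rewrite g_rho// => /cvgrPdist_lt/(_ _ e3)[N _ /(_ N (leqnn _))] /=.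
  rewrite sub0r normrN => h; exists N; exact: le_lt_trans (ler_norm _) h.
have crho z : rho z < e / (c * 3) -> c * rho z < e / 3.
  move=> h; rewrite -ltr_pdivlMl//.
  suff -> : c^-1 * (e / 3) = e / (c * 3) by [].
  by field; rewrite gt_eqF.
near=> z.
have Qz : Q z by near: z; exact: open_nbhs_nbhs.
have h1 := g_dist y k Qy; have h2 := g_dist z k Qz.
have h3 : c * rho (y, x k y) < e / 3 by exact: crho.
have h4 : c * rho (z, x k z) < e / 3.
  apply: crho; near: z; apply: (cvgr_lt (rho (y, x k y))) => //.
  exact: rho_cont.
have h5 : `|x k y - x k z| < e / 3.
  near: z; apply: cvgr_dist_lt; last by rewrite divr_gt0.
  exact: x_cont.
have -> : g y - g z = (g y - x k y) + (x k y - x k z) + (x k z - g z).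
  by rewrite !addrA subrK subrK.
have := ler_normD ((g y - x k y) + (x k y - x k z)) (x k z - g z).
have := ler_normD (g y - x k y) (x k y - x k z).
by rewrite (distrC (x k z)); lra.
Unshelve. all: by end_near. Qed.

(** * Operator norms *)

Lemma le_opnorm {R : realType} {V W : normedModType R}
    (A : bounded_operator V W) (v : V) : `|A v| <= opnorm A * `|v|.
Proof.
have [->|v0] := eqVneq v 0; first by rewrite linear0 !normr0 mulr0.
have nv : 0 < `|v| by rewrite normr_gt0.
rewrite -ler_pdivrMr//; apply: ub_le_sup.
  have [M HM] := bop_bounded A 1.
  by exists M => _ [u /= u1 <-]; exact: HM.
exists (`|v|^-1 *: v) => /=.
  by rewrite normrZ gtr0_norm ?invr_gt0// mulVf// gt_eqF.
by rewrite linearZ/= normrZ gtr0_norm ?invr_gt0// mulrC.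
Qed.

Lemma opnorm_le {R : realType} {V W : normedModType R}
    (A : bounded_operator V W) (k : R) :
  0 <= k -> (forall v, `|A v| <= k * `|v|) -> opnorm A <= k.
Proof.
move=> k0 Ak; apply: ge_sup; first by exists `|A 0|; exists 0; rewrite //= normr0.
move=> _ [v /= v1 <-]; apply: le_trans (Ak v) _.
by rewrite -[leRHS]mulr1 ler_wpM2l.
Qed.

Lemma opnorm_ge0 {R : realType} {V W : normedModType R}
    (A : bounded_operator V W) : 0 <= opnorm A.
Proof.
have [M HM] := bop_bounded A 1.
apply: (@le_trans _ _ `|A 0|); first exact: normr_ge0.
apply: ub_le_sup; last by exists 0; rewrite //= normr0.
by exists M => _ [u /= u1 <-]; exact: HM.
Qed.


(** * Construction of the descent step *)

Lemma convex_comb_dist_le {R : realType} {U : normedModType R} {I : eqType}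
    (s : seq I) (c : I -> R) (u : I -> U) (z : U) (b : R) :
  (forall j, 0 <= c j) -> \sum_(j <- s) c j = 1 ->
  (forall j, j \in s -> `|u j - z| <= b) ->
  `|\sum_(j <- s) c j *: u j - z| <= b.
Proof.
move=> c0 c1 ub.
have -> : \sum_(j <- s) c j *: u j - z = \sum_(j <- s) c j *: (u j - z).
  under [RHS]eq_bigr do rewrite scalerBr.
  by rewrite sumrB -scaler_suml c1 scale1r.
apply: (le_trans (ler_norm_sum _ _ _)).
rewrite -[b]mul1r -c1 mulr_suml big_seq [leRHS]big_seq.
by apply: ler_sum => j js; rewrite normrZ ger0_norm// ler_wpM2l// ub.
Qed.

(** Fix [delta > 0] with [M = c (1 - a - 2 delta)], [c = m / (1 - a)].  The
    direction [phi] glues the vectors [L x_i w_i], [w_i = y_i - f x_i], over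
    neighbourhoods on which [|w - w_i| <= delta |w_i|].  There
    [|phi| <= M / (1 - delta) |w|] and
    [|Df x' phi - w| <= (a + delta) / (1 - delta) |w|] for [x'] on the segment
    from [x] to [x + h phi].  By the mean value inequality the residual loses at
    least [h |w| (1 - a - 2 delta) / (1 - delta)], which is [1 / c] times the
    bound on the length [h |phi|] of the step.  The slack between [M] and [m] is
    what pays for [delta] while keeping the constant [c].  Where [f x = y] the
    step is zero, and the estimate itself gives continuity at such points. *)
Lemma descent_step {R : realType} {X Y : normedModType R} (r : R) (f : X -> Y)
    (K : R) (Df : X -> bounded_operator X Y) (L : X -> bounded_operator Y X)
    (a : R) (alpha : X -> Y -> R) (M m : R) :
  0 <= K ->
  (forall x x', `|x| < r -> `|x'| < r -> `|f x - f x'| <= K * `|x - x'|) ->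
  (forall x, `|x| < r -> is_gateaux_diff f x (Df x)) ->
  a < 1 ->
  (forall x w, `|x| < r -> 0 < alpha x w) ->
  (forall x w, `|x| < r -> forall x', `|x' - x| < alpha x w ->
     `|x'| < r /\ `|Df x' (L x w) - w| <= a * `|w|) ->
  0 < M < m ->
  (forall x w, `|x| < r -> `|L x w| <= M * `|w|) ->
  exists S : Y * X -> X, forall y x, `|x| < r ->
    [/\ {for (y, x), continuous S},
        `|S (y, x) - x| <= m / (1 - a) * (`|y - f x| - `|y - f (S (y, x))|) &
        (S (y, x) = x -> y = f x)].
Proof.
move=> K0 flip fD a1 alpha0 approx /andP[M0 Mm] LM.
have m0 : 0 < m by exact: lt_trans Mm.
pose delta := (1 - a) * (1 - M / m) / 2.
have Mm1 : 0 < M / m < 1 by rewrite divr_gt0//= ltr_pdivrMr// mul1r.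
have delta0 : 0 < delta by rewrite divr_gt0// mulr_gt0//; lra.
pose c := m / (1 - a).
have c0 : 0 < c by rewrite divr_gt0// subr_gt0.
pose w (t : Y * X) := t.1 - f t.2.
pose good (t : Y * X) := `|t.2| < r /\ w t <> 0.
(* in the trivial space Y the constant a may be negative *)
have a_ge0 t : good t -> 0 <= a.
  move=> [tr /eqP wt]; have := approx _ (w t) tr t.2.
  rewrite subrr normr0 => /(_ (alpha0 _ _ tr))[_ /(le_trans (normr_ge0 _))].
  by rewrite pmulr_lge0// normr_gt0.
(* b i is the radius of the neighbourhood of i.  The factor 1 + K is the Lipschitz
   constant of w; the term 4 * m * `|w i| leaves room for the step, whose
   direction has norm at most 4 * m * `|w i|.  The radius 0 off the good set
   disables the other indices. *)
have /choice[b bP] : forall t : Y * X, exists b : R, [/\ 0 <= b <= 1,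
    (0 < b -> good t) & (good t -> [/\ 0 < b, b * (1 + K) <= delta * `|w t| &
       b * (1 + 4 * m * `|w t|) <= alpha t.2 (w t)])].
  move=> t; have [gt|ngt] := pselect (good t); last first.
    by exists 0; rewrite lexx ler01 ltxx; split.
  have [tr /eqP wt] := gt; have := alpha0 _ (w t) tr => at0.
  have wt0 : 0 < `|w t| by rewrite normr_gt0.
  have K1 : 0 < 1 + K by lra.
  have m1 : 0 < 1 + 4 * m * `|w t| by rewrite addr_gt0// !mulr_gt0.
  exists (Num.min 1 (Num.min (delta * `|w t| / (1 + K))
     (alpha t.2 (w t) / (1 + 4 * m * `|w t|)))).
  have b0 : 0 < Num.min 1 (Num.min (delta * `|w t| / (1 + K))
     (alpha t.2 (w t) / (1 + 4 * m * `|w t|))).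
    by rewrite !lt_min ltr01/= !divr_gt0// mulr_gt0.
  split=> // [|_]; first by rewrite (ltW b0)/= ge_min lexx.
  by split=> //; rewrite -ler_pdivlMr// !ge_min lexx ?orbT.
pose d (i t : Y * X) := Num.max 0 (b i - `|t - i|).
have d01 i t : 0 <= d i t <= 1.
  have [/andP[bi0 bi1] _ _] := bP i.
  rewrite /d le_max lexx ge_max ler01/=; have := normr_ge0 (t - i); lra.
have dlip i s t : d i s <= d i t + `|s - t|.
  apply: max0_le_add => //; have := ler_distD s t i.
  by rewrite (distrC t s); lra.
have [h [phi [hcont sel]]] := continuous_convex_selection d (fun i => L i.2 (w i)) d01 dlip.
pose S t := if w t == 0 then t.2 else t.2 + h t *: phi t.
have [/= norm1 norm2] : (forall t : Y * X, `|t.1| <= `|t|) /\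
    (forall t : Y * X, `|t.2| <= `|t|).
  by split=> t; rewrite prod_normE le_max lexx ?orbT.
have w_lip s t : `|s.2| < r -> `|t.2| < r -> `|w s - w t| <= (1 + K) * `|s - t|.
  move=> sr tr; have -> : w s - w t = (s.1 - t.1) - (f s.2 - f t.2).
    by rewrite /w !opprD !opprK addrACA.
  apply: le_trans (ler_normB _ _) _; rewrite mulrDl mul1r lerD//.
    exact: (norm1 (s - t)).
  by apply: le_trans (flip _ _ sr tr) _; rewrite ler_wpM2l//; exact: (norm2 (s - t)).
have delta_eq : M = c * (1 - a - 2 * delta).
  by rewrite /c /delta; field; rewrite !gt_eqF// subr_gt0.
have w_cont t : `|t.2| < r -> {for t, continuous w}.
  move=> tr; apply/cvgrPdist_le => e e0; near=> s.
  have sr : `|s.2| < r.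
    near: s; apply: (cvgr_norm_lt t.2) => //; exact: cvg_snd.
  apply: le_trans (w_lip t s tr sr) _; rewrite mulrC -ler_pdivlMr; last by lra.
  by near: s; apply: cvgr_dist_le => //; rewrite divr_gt0//; lra.
have main y x : `|x| < r -> w (y, x) <> 0 ->
    [/\ {for (y, x), continuous phi}, h (y, x) *: phi (y, x) <> 0 &
       `|h (y, x) *: phi (y, x)| <= c * (`|y - f x| -
           `|y - f (x + h (y, x) *: phi (y, x))|)].
  set t := (y, x) => xr wt0.
  have [_ _ bt] := bP t; have [bt0 _ _] := bt (conj xr wt0).
  have dt : 0 < d t t by rewrite /d subrr normr0 subr0 lt_max bt0 orbT.
  have {sel} [phic ht [s [cf [cf0 cf1 phiE act]]]] := sel _ _ dt.
  have a0 : 0 <= a by apply: (a_ge0 t).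
  have nw : 0 < `|w t| by rewrite normr_gt0; exact/eqP.
  have delta1 : delta <= 1 / 2.
    have : (1 - a) * (1 - M / m) <= 1 * 1 by apply: ler_pM; lra.
    by rewrite /delta; lra.
  have actP j : j \in s -> [/\ good j /\ h t <= 1,
      `|x - j.2| <= b j - h t, (1 - delta) * `|w j| <= `|w t|,
      `|w t - w j| <= delta * `|w j| &
      b j * (1 + 4 * m * `|w j|) <= alpha j.2 (w j)].
    move=> js; have hd := act _ js.
    have [/andP[bj0 bj1] bg gb] := bP j.
    have hb : h t <= b j - `|t - j|.
      by move: hd; rewrite /d le_max leNgt ht.
    have tj0 := normr_ge0 (t - j).
    have gj : good j by apply: bg; lra.
    have [_ bw balpha] := gb gj.
    have wtj : `|w t - w j| <= delta * `|w j|.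
      apply: le_trans (w_lip t j xr gj.1) _; apply: le_trans bw.
      rewrite mulrC ler_wpM2r//; lra.
    split=> //; first by split=> //; lra.
    - by have := norm2 (t - j); rewrite /=; lra.
    - have := ler_normD (w j - w t) (w t).
      by rewrite subrK (distrC (w j) (w t)); lra.
  have vj j : j \in s -> `|L j.2 (w j)| <= M / (1 - delta) * `|w t|.
    move=> js; have [[gj _] _ wj _ _] := actP _ js.
    apply: le_trans (LM _ _ gj.1) _; rewrite -mulrA ler_pM2l// ler_pdivlMl//.
    lra.
  have phi_le : `|phi t| <= M / (1 - delta) * `|w t|.
    rewrite phiE -[X in `|X|]subr0.
    by apply: convex_comb_dist_le => // j js; rewrite subr0; exact: vj.
  have Mdelta : M / (1 - delta) <= 2 * m.
    rewrite ler_pdivrMr; last lra.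
    have : m * (1 / 2) <= m * (1 - delta) by rewrite ler_pM2l//; lra.
    lra.
  (* the segment travelled stays in the ball where the choice made at j is good *)
  have near_j j tau : 0 <= tau <= h t -> j \in s ->
      `|(x + tau *: phi t) - j.2| < alpha j.2 (w j).
    move=> /andP[tau0 tauh] js; have [[gj h1] xj wj wtj balpha] := actP _ js.
    have wt2 : `|w t| <= 2 * `|w j|.
      have : delta * `|w j| <= 1 / 2 * `|w j| by rewrite ler_wpM2r.
      have := ler_normD (w t - w j) (w j); rewrite subrK.
      have := normr_ge0 (w j); lra.
    have phi4 : `|phi t| <= 4 * m * `|w j|.
      apply: le_trans phi_le _.
      apply: (@le_trans _ _ (2 * m * (2 * `|w j|))); last by lra.
      by apply: ler_pM => //; rewrite divr_ge0 ?ltW//; lra.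
    rewrite addrAC; apply: le_lt_trans (ler_normD _ _) _.
    rewrite normrZ (ger0_norm tau0); apply: lt_le_trans balpha.
    have : tau * `|phi t| <= b j * (4 * m * `|w j|).
      apply: ler_pM => //; have := normr_ge0 (x - j.2); lra.
    rewrite mulrDr mulr1; lra.
  have [j0 j0s] : exists j, j \in s.
    case: (s) cf1 => [|j s' _]; last by exists j; rewrite mem_head.
    by rewrite big_nil => /esym/eqP; rewrite oner_eq0.
  have h1 : h t <= 1 by case: (actP _ j0s) => -[].
  pose theta := (a + delta) / (1 - delta).
  have Dphi tau : 0 <= tau <= h t ->
      `|x + tau *: phi t| < r /\
      `|Df (x + tau *: phi t) (phi t) - w t| <= theta * `|w t|.
    move=> tauh; split.
      have [[gj _] _ _ _ _] := actP _ j0s.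
      by have [] := approx _ (w j0) gj.1 _ (near_j _ _ tauh j0s).
    rewrite phiE linear_sum; under eq_bigr do rewrite linearZ/=.
    apply: convex_comb_dist_le => // j js.
    have [[gj _] _ wj wtj _] := actP _ js.
    have [_ Da] := approx _ (w j) gj.1 _ (near_j _ _ tauh js).
    rewrite phiE in Da.
    apply: le_trans (ler_distD (w j) _ _) _; rewrite (distrC (w j)).
    apply: (@le_trans _ _ ((a + delta) * `|w j|)); first by rewrite mulrDl lerD.
    rewrite /theta -mulrA ler_wpM2l//; first by lra.
    by rewrite ler_pdivlMl//; lra.
  have mv : `|y - f (x + h t *: phi t)| <= (1 - h t) * `|w t| + theta * `|w t| * h t.
    pose psi tau := f (x + tau *: phi t) - (0 + tau *: w t).
    have : `|psi (h t) - psi 0| <= theta * `|w t| * h t.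
      apply: (@norm_mean_value _ _ _
        (fun tau => Df (x + tau *: phi t) (phi t) - w t)); first exact: ltW.
        move=> tau /Dphi[xt _]; apply: is_deriveB.
          by apply: is_derive_along_line; exact: fD.
        exact: is_derive_along_line.
      by move=> tau /Dphi[].
    rewrite /psi !add0r !scale0r addr0 subr0 => psih.
    have -> : y - f (x + h t *: phi t) = (1 - h t) *: w t -
        (f (x + h t *: phi t) - h t *: w t - f x).
      rewrite [_ - f x]addrAC opprB scalerBl scale1r addrA subrK /w/=.
      by rewrite opprB addrA subrK.
    apply: le_trans (ler_normB _ _) _; apply: lerD => //.
    by rewrite normrZ ger0_norm//; lra.
  have gain : h t * `|phi t| <= c * (`|w t| - `|y - f (x + h t *: phi t)|).
    apply: (@le_trans _ _ (c * (h t * (1 - theta) * `|w t|))).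
      have -> : c * (h t * (1 - theta) * `|w t|) = h t * (M / (1 - delta) * `|w t|).
        rewrite [in RHS]delta_eq /theta; field.
        by apply/eqP; lra.
      by rewrite ler_pM2l.
    by rewrite ler_pM2l//; lra.
  split=> //.
    move=> hphi0; move: mv; rewrite hphi0 addr0 leNgt => /negP; apply.
    rewrite -/(w t).
    have theta1 : 0 < 1 - theta.
      rewrite /theta subr_gt0 ltr_pdivrMr; last by lra.
      by have := delta_eq; rewrite -subr_gt0; nra.
    have : 0 < h t * (1 - theta) * `|w t| by rewrite !mulr_gt0.
    lra.
  by rewrite normrZ gtr0_norm.
have Sle y x : `|x| < r ->
    `|S (y, x) - x| <= c * (`|y - f x| - `|y - f (S (y, x))|).
  move=> xr; rewrite /S; case: eqP => [_|w0] /=.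
    by rewrite !subrr normr0 mulr0.
  by have [_ _] := main _ _ xr w0; rewrite addrAC subrr add0r.
exists S => y x xr; split=> //.
- have [w0|w0] := eqVneq (w (y, x)) 0; last first.
    have [phic _ _] := main _ _ xr (elimN eqP w0).
    apply: (@cvg_trans _ ((fun t => t.2 + h t *: phi t) @ (y, x))).
      apply: near_eq_cvg; near=> s; rewrite /S ifN//.
      near: s; apply: (cvgr_neq0 (w (y, x))) w0; exact: (w_cont (y, x)).
    have -> : S (y, x) = x + h (y, x) *: phi (y, x) by rewrite /S ifN.
    have s2 : (t.2 @[t --> (y, x)]) --> x by exact: cvg_snd.
    have s3 : (h t *: phi t @[t --> (y, x)]) --> h (y, x) *: phi (y, x).
      by apply: cvgZ => //; exact: hcont.
    exact: cvgD s2 s3.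
  have Sx : S (y, x) = x by rewrite /S w0 eqxx.
  change (S t @[t --> (y, x)] --> S (y, x)); rewrite Sx.
  apply/cvgrPdist_lt => e e0; near=> s.
  have sr : `|s.2| < r.
    by near: s; apply: (cvgr_norm_lt x) => //; exact: cvg_snd.
  have ws : c * `|w s| < e / 2.
    rewrite -ltr_pdivlMl//; near: s; apply: (cvgr_norm_lt (w (y, x))).
      exact: w_cont.
    by rewrite w0 normr0; apply: mulr_gt0; rewrite ?invr_gt0// divr_gt0.
  have xs : `|x - s.2| < e / 2.
    near: s; apply: cvgr_dist_lt; last by rewrite divr_gt0.
    exact: cvg_snd.
  have Ss : `|S s - s.2| <= c * `|w s|.
    case: (s) sr => s1 s2 /= sr; apply: le_trans (Sle _ _ sr) _.
    by rewrite ler_pM2l// gerBl.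
  by apply: le_lt_trans (ler_distD s.2 _ _) _; rewrite (distrC s.2); lra.
- exact: Sle.
- have [w0 _|w0] := pselect (w (y, x) = 0); first exact: subr0_eq w0.
  rewrite /S ifN; last exact/eqP.
  have [_ h0 _] := main _ _ xr w0.
  by move=> /(congr1 (fun z => z - x)); rewrite addrAC subrr add0r.
Unshelve. all: by end_near. Qed.

(** * Uniqueness of the continuous right inverse *)

Lemma ball0P {R : realType} {V : normedModType R} (e : R) (x : V) :
  ball (0 : V) e x <-> `|x| < e.
Proof. by rewrite -ball_normE/= sub0r normrN. Qed.

(** For a left inverse [N] of [D], the identity [N w = L w - N (D (L w) - w)] gives
    [|N| <= M + a |N|], so [|N| <= M / (1 - a)] whatever the size of [N] given at
    first. *)
Lemma left_inverse_lower_bound {R : realType} {X Y : normedModType R}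
    (D : bounded_operator X Y) (L : bounded_operator Y X) (a M : R) :
  0 <= a < 1 -> 0 <= M -> has_left_inverse D ->
  (forall w, `|D (L w) - w| <= a * `|w|) -> (forall w, `|L w| <= M * `|w|) ->
  forall h, `|h| <= M / (1 - a) * `|D h|.
Proof.
move=> /andP[a0 a1] M0 [N ND] Da LM h.
have N0 := opnorm_ge0 N.
have Nle : opnorm N <= M + opnorm N * a.
  apply: opnorm_le => [|w]; first by rewrite addr_ge0// mulr_ge0.
  have -> : N w = L w - N (D (L w) - w) by rewrite linearB/= ND opprB addrC subrK.
  apply: le_trans (ler_normB _ _) _; rewrite mulrDl lerD//.
  by apply: le_trans (le_opnorm N _) _; rewrite -mulrA ler_wpM2l.
rewrite -{1}(ND h); apply: le_trans (le_opnorm N _) _.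
rewrite ler_wpM2r// ler_pdivlMr; lra.
Qed.

(** If [f x1 = f x2], then [|x2 - x1| <= c |Df x1 (x2 - x1)|], and the modulus bounds
    the right-hand side by [c eps(|x2 - x1|) |x2 - x1|].  So distinct solutions are
    at distance at least some [d0 > 0], and the continuous function
    [t |-> |g (t y) - g' (t y)|], zero at [t = 0], cannot leave [0] without taking
    the value [d0 / 2]. *)
Lemma right_inverse_unique {R : realType} {X Y : normedModType R} (r s c : R)
    (f : X -> Y) (Df : X -> bounded_operator X Y) (eps : R -> R)
    (g g' : Y -> X) :
  0 < c ->
  (forall x h, ball (0 : X) r x -> `|h| <= c * `|Df x h|) ->
  eps t @[t --> 0^'+] --> 0 ->
  (forall x1 x2, ball (0 : X) r x1 -> ball (0 : X) r x2 ->
     `|f x2 - f x1 - Df x1 (x2 - x1)| <= eps `|x2 - x1| * `|x2 - x1|) ->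
  continuous_right_inverse f (ball (0 : X) r) (ball (0 : Y) s) g ->
  continuous_right_inverse f (ball (0 : X) r) (ball (0 : Y) s) g' ->
  g 0 = g' 0 -> forall y, ball (0 : Y) s y -> g y = g' y.
Proof.
move=> c0 lowD eps0 fD [gc gB fg] [g'c g'B fg'] g0 y ys.
have c20 : 0 < (2 * c)^-1 by rewrite invr_gt0 mulr_gt0.
have [d0 d0_gt0 d0P] : exists2 d0, 0 < d0 &
    forall x1 x2, ball (0 : X) r x1 -> ball (0 : X) r x2 -> f x1 = f x2 ->
      `|x2 - x1| < d0 -> x1 = x2.
  have /cvgrPdist_lt/(_ _ c20) := eps0.
  rewrite near_withinE => /nbhs_norm0P[/= d0 d00 dP].
  exists d0 => // x1 x2 B1 B2 f12 xd; apply: contrapT => x12.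
  have x0 : 0 < `|x2 - x1| by rewrite normr_gt0 subr_eq0 eq_sym; exact/eqP.
  have := dP `|x2 - x1|; rewrite /= normr_id => /(_ xd x0).
  rewrite sub0r normrN => e1.
  have := fD _ _ B1 B2; rewrite f12 subrr sub0r normrN => e2.
  have := lowD x1 (x2 - x1) B1; rewrite leNgt => /negP; apply.
  rewrite -ltr_pdivlMl//; apply: le_lt_trans e2 _; rewrite ltr_pM2r//.
  apply: le_lt_trans (ler_norm _) _; apply: lt_trans e1 _.
  by rewrite ltf_pV2 ?posrE ?mulr_gt0// ltr_pMl// ltr1n.
have B't t : 0 <= t <= 1 -> ball (0 : Y) s (t *: y).
  move=> /andP[t0 t1]; apply/ball0P; move/ball0P : ys; apply: le_lt_trans.
  by rewrite normrZ ger0_norm// ler_piMl.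
have cont G : {within ball (0 : Y) s, continuous G} ->
    forall t : R, 0 <= t <= 1 -> {for t, continuous (fun t : R => G (t *: y) : X)}.
  rewrite continuous_open_subspace; last exact: ball_open.
  move=> Gc t t01; apply: continuous_comp.
    by apply: cvgZl; exact: cvg_id.
  by apply: Gc; rewrite inE; exact: B't.
pose u (t : R) := `|g (t *: y) - g' (t *: y)|.
have uc : {within `[0, 1], continuous u}.
  apply: continuous_in_subspaceT => t; rewrite inE/= in_itv/= => t01.
  by apply: cvg_norm; apply: cvgB; exact: cont.
have small t : 0 <= t <= 1 -> u t < d0 -> u t = 0.
  move=> t01 ut; have Bt := B't _ t01.
  have := d0P _ _ (g'B _ Bt) (gB _ Bt); rewrite fg// fg'// => /(_ erefl ut).
  by rewrite /u => ->; rewrite subrr normr0.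
have u0 : u 0 = 0 by rewrite /u !scale0r g0 subrr normr0.
have u1 : u 1 < d0.
  rewrite ltNge; apply/negP => d0u.
  have [|t] := @IVT _ u 0 1 (d0 / 2) ler01 uc.
    by rewrite u0 ge_min le_max; apply/andP; split; apply/orP; [left|right]; lra.
  rewrite in_itv/= => t01 ut.
  have : u t = 0 by apply: small => //; lra.
  lra.
have := small 1; rewrite lexx ler01 => /(_ isT u1).
by rewrite /u scale1r => /normr0_eq0/subr0_eq.
Qed.

(** * The surjection theorem *)

Theorem theorem2 (R : realType) (X Y : completeNormedModType R)
  (r : R) (r_gt0 : 0 < r)
  (f : X -> Y) (f0 : f 0 = 0)
  (f_lip : [lipschitz f x | x in ball (0 : X) r])
  (Df : X -> bounded_operator X Y)
  (f_gateaux : forall x, ball (0 : X) r x -> is_gateaux_diff f x (Df x))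
  (L : X -> bounded_operator Y X) (a : R) (a_lt1 : a < 1)
  (alpha : X -> Y -> R)
  (alpha_gt0 : forall x w, ball (0 : X) r x -> 0 < alpha x w)
  (approx_right_inv : forall x w, ball (0 : X) r x ->
     forall x' : X, `|x' - x| < alpha x w ->
       ball (0 : X) r x' /\ `|Df x' (L x w) - w| <= a * `|w|)
  (m : R)
  (L_lt_m : (ereal_sup [set (opnorm (L x))%:E | x in ball (0%R : X) r] < m%:E)%E) :
  let B := ball (0 : X) r in
  let B' := ball (0 : Y) ((1 - a) * r * m^-1) in
  exists g : Y -> X,
    [/\ continuous_right_inverse f B B' g,
        (forall y, B' y -> `|g y| <= m / (1 - a) * `|y|) &
        ((forall x, B x -> differentiable f x) ->
         (forall x, B x -> has_left_inverse (Df x)) ->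
         (exists eps : R -> R,
           [/\ (forall t, 0 < t -> 0 < eps t),
               (forall s t, 0 < s -> s <= t -> eps s <= eps t),
               eps t @[t --> 0^'+] --> 0 &
               (forall x1 x2, B x1 -> B x2 ->
                 `|f x2 - f x1 - Df x1 (x2 - x1)|
                   <= eps `|x2 - x1| * `|x2 - x1|)]) ->
         g 0 = 0 /\
         forall g' : Y -> X,
           continuous_right_inverse f B B' g' -> g' 0 = 0 ->
           forall y, B' y -> g' y = g y)].

Proof.
move=> B B'.
have BP (x : X) : `|x| < r <-> B x by rewrite /B; split=> /ball0P.
have B0 : B 0 by apply/BP; rewrite normr0.
have [M /andP[M0 Mm] LM] : exists2 M, 0 < M < m &
    forall x w, B x -> `|L x w| <= M * `|w|.
  have LE x : B x -> ((opnorm (L x))%:E <=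
      ereal_sup [set (opnorm (L x))%:E | x in ball (0%R : X) r])%E.
    by move=> Bx; apply: ereal_sup_ubound; exists x.
  move: L_lt_m LE; case: ereal_sup => [s|_ /(_ _ B0)|_ /(_ _ B0)] //.
  rewrite lte_fin => sm LE.
  have s0 : 0 <= s by apply: le_trans (opnorm_ge0 (L 0)) _; rewrite -lee_fin LE.
  have m0 : 0 < m by exact: le_lt_trans sm.
  (* the supremum s may vanish, and the step needs a positive bound below m *)
  exists (Num.max s (m / 2)).
    by rewrite lt_max gt_max sm /= divr_gt0 ?orbT//=; lra.
  move=> x w Bx; apply: le_trans (le_opnorm _ _) _; rewrite ler_wpM2r//.
  by rewrite le_max; apply/orP; left; rewrite -lee_fin LE.
have m0 : 0 < m by exact: lt_trans Mm.
have a1 : 0 < 1 - a by rewrite subr_gt0.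
have c0 : 0 < m / (1 - a) by rewrite divr_gt0.
have B'P (y : Y) : B' y -> m / (1 - a) * `|y| < r.
  move=> /ball0P; rewrite ltr_pdivlMr// => yr.
  by rewrite mulrAC ltr_pdivrMr// mulrC [ltRHS]mulrC.
have [K K0 flip] : exists2 K, 0 <= K & forall x x' : X, `|x| < r -> `|x'| < r ->
    `|f x - f x'| <= K * `|x - x'|.
  have [K [Kreal KP]] := f_lip.
  exists (Num.max 0 (K + 1)); first by rewrite le_max lexx.
  move=> x x' /BP Bx /BP Bx'.
  apply: (KP (Num.max 0 (K + 1)) _ (x, x')) => //.
  by rewrite lt_max ltrDl ltr01 orbT.
have [S SP] : exists S : Y * X -> X, forall y x, `|x| < r ->
    [/\ {for (y, x), continuous S},
        `|S (y, x) - x| <= m / (1 - a) * (`|y - f x| - `|y - f (S (y, x))|) &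
        (S (y, x) = x -> y = f x)].
  apply: (@descent_step _ _ _ r f K Df L a alpha M m) => //.
  - by move=> x /BP; exact: f_gateaux.
  - by move=> x w /BP; exact: alpha_gt0.
  - move=> x w /BP Bx x' xx'.
    by have [/BP Bx' ?] := approx_right_inv _ w Bx x' xx'.
  - by rewrite M0.
  - by move=> x w /BP; exact: LM.
pose rho (z : Y * X) := `|z.1 - f z.2|.
have [g gP] : exists g : Y -> X, forall y, B' y ->
    [/\ {for y, continuous g}, `|g y| <= m / (1 - a) * rho (y, 0) &
        rho (y, g y) = 0].
  apply: (@continuous_descent _ _ _ B' r _ S rho) => //.
  - exact: ball_open.
  - by move=> z; exact: normr_ge0.
  - move=> y x _ xr; split; first by have [] := SP y x xr.
    have fx : {for x, continuous f}.
      apply/cvgrPdist_le => e e0; near=> x'.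
      have x'r : `|x'| < r by near: x'; exact: (cvgr_norm_lt x).
      apply: le_trans (flip _ _ xr x'r) _.
      apply: (@le_trans _ _ ((K + 1) * `|x - x'|)).
        by rewrite ler_wpM2r// lerDl.
      rewrite mulrC -ler_pdivlMr; last by lra.
      by near: x'; apply: cvgr_dist_le => //; rewrite divr_gt0//; lra.
    have s1 : (t.1 @[t --> (y, x)]) --> y by exact: cvg_fst.
    have s2 : (f t.2 @[t --> (y, x)]) --> f x.
      by apply: (@cvg_comp _ _ _ snd f _ (nbhs x)) => //; exact: cvg_snd.
    exact: cvg_norm (cvgB s1 s2).
  - by move=> y x _ xr; have [] := SP y x xr.
  - move=> y x _ xr Sx; have [_ _ /(_ Sx) ->] := SP y x xr.
    by rewrite /rho subrr normr0.
  - by move=> y /B'P; rewrite /rho /= f0 subr0.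
have g_le y : B' y -> `|g y| <= m / (1 - a) * `|y|.
  by move=> /gP[_]; rewrite /rho/= f0 subr0.
have g_right_inverse : continuous_right_inverse f B B' g.
  split.
  - rewrite continuous_open_subspace; last exact: ball_open.
    by move=> y; rewrite inE => /gP[].
  - by move=> y B'y; apply/BP; apply: le_lt_trans (g_le _ B'y) _; exact: B'P.
  - by move=> y /gP[_ _ /normr0_eq0/subr0_eq].
exists g; split=> // _ left_inv [eps [_ _ eps0 epsP]].
have B'0 : B' 0 by apply/ball0P; rewrite normr0 !mulr_gt0// invr_gt0.
have g0 : g 0 = 0.
  by apply/normr0_eq0/le_anti; rewrite normr_ge0 andbT -(mulr0 (m / (1 - a)))
     -(@normr0 _ Y); exact: g_le.
split=> // g' g'P g'0 y B'y.
have [->|y0] := eqVneq y 0; first by rewrite g0 g'0.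
have LD x w : B x -> `|Df x (L x w) - w| <= a * `|w|.
  move=> Bx; have [] // := approx_right_inv x w Bx x.
  by rewrite subrr normr0; exact: alpha_gt0.
(* a is nonnegative as soon as Y has a nonzero vector *)
have a0 : 0 <= a.
  have := le_trans (normr_ge0 _) (LD 0 y B0).
  by rewrite pmulr_lge0// normr_gt0.
have M1 : 0 < M / (1 - a) by rewrite divr_gt0.
apply: (@right_inverse_unique _ _ _ r _ (M / (1 - a)) f Df eps g' g) => //.
- move=> x h Bx; apply: (@left_inverse_lower_bound _ _ _ _ (L x)) => //.
  - by rewrite a0.
  - exact: ltW.
  - exact: left_inv.
  - by move=> w; exact: LD.
  - by move=> w; exact: LM.
- exact: g'P.
- exact: g_right_inverse.
- by rewrite g0.
- exact: B'y.
Unshelve. all: by end_near. Qed.
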